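(* Let $S$ be a square. There is no perfect Mondrian $6$-partition $\mathcal{P}=\{R_1,\dots,R_6\}$ of $S$.
   Context: All rectangles have real side lengths. Two rectangles are congruent, written $R_1\cong R_2$, if the lengths of their sides (not necessarily in the same order) are equal. A $k$-partition ($k\ge 2$) of a rectangle $R$ is a tiling of $R$ by $k$ rectangles $R_1,\dots,R_k$. A partition $\{R_1,\dots,R_k\}$ of $R$ is a Mondrian partition if $R_i\not\cong R_j$ for all $i\ne j$. A Mondrian partition is perfect if $\mathrm{area}(R_i)=\frac1k\,\mathrm{area}(R)$ for every $i$. Squares are special cases of rectangles. *)

(* Defs.v *)
From Stdlib Require Import Reals Arith.
Open Scope R_scope.

(* A nondegenerate rectangle in the plane, in arbitrary position: one vertex
   (vx, vy), a unit vector (ux, uy) along the side of length [width], and its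
   rotation by a quarter turn (- uy, ux) along the side of length [height].
   Since a tiling of a rectangle is not assumed a priori to have sides parallel
   to those of the rectangle, the direction is part of the data. *)
Record rectangle : Type := Rectangle {
  vx : R;
  vy : R;
  ux : R;
  uy : R;
  width : R;
  height : R;
  u_unit : ux ^ 2 + uy ^ 2 = 1;
  width_pos : 0 < width;
  height_pos : 0 < height
}.

(* The point with coordinates (s, t) in the orthonormal frame of [r]. *)
Definition frame_point (r : rectangle) (s t : R) : R * R :=
  (vx r + s * ux r - t * uy r, vy r + s * uy r + t * ux r).

Definition in_rectangle (r : rectangle) (p : R * R) : Prop :=
  exists s t : R,
    0 <= s <= width r /\ 0 <= t <= height r /\ p = frame_point r s t.

Definition in_interior (r : rectangle) (p : R * R) : Prop :=
  exists s t : R,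
    0 < s < width r /\ 0 < t < height r /\ p = frame_point r s t.

Definition area (r : rectangle) : R := width r * height r.

Definition is_square (r : rectangle) : Prop := width r = height r.

Definition congruent (r1 r2 : rectangle) : Prop :=
  (width r1 = width r2 /\ height r1 = height r2) \/
  (width r1 = height r2 /\ height r1 = width r2).

(* The tiles are P 0, ..., P (k - 1); the values of [P] at indices >= k are
   irrelevant. *)
Definition partition (k : nat) (r : rectangle) (P : nat -> rectangle) : Prop :=
  (2 <= k)%nat /\
  (forall p : R * R,
     in_rectangle r p <-> exists i : nat, (i < k)%nat /\ in_rectangle (P i) p) /\
  (forall i j : nat, (i < k)%nat -> (j < k)%nat -> i <> j ->
     forall p : R * R, ~ (in_interior (P i) p /\ in_interior (P j) p)).

Definition mondrian_partition (k : nat) (r : rectangle)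
    (P : nat -> rectangle) : Prop :=
  partition k r P /\
  forall i j : nat, (i < k)%nat -> (j < k)%nat -> i <> j ->
    ~ congruent (P i) (P j).

Definition perfect_mondrian_partition (k : nat) (r : rectangle)
    (P : nat -> rectangle) : Prop :=
  mondrian_partition k r P /\
  forall i : nat, (i < k)%nat -> area (P i) = 1 / INR k * area r.

(* Main.v *)
Require Import Defs.
From Stdlib Require Import Reals Arith.
From Stdlib Require Import List Bool Lia Lra Permutation Sorted Mergesort.
From Stdlib Require Import Orders.
Import ListNotations.
Open Scope R_scope.

(** Two tiles of equal area are congruent as soon as one side of the first has
    the length of a side of the second.  The theorem follows from three facts.

    - The tiles are parallel to the sides of the tiled rectangle
      ([box_tiling_straight]).  Otherwise take the tilted tile whose lowest
      vertex p is lowest, and look at the points p + (- e, e ^ 2) for small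
      positive e.  They leave every tilted tile, because such a tile lies
      weakly above the level of p and its sides have nonzero slope.  They also
      leave every straight tile, because a straight tile containing them for
      arbitrarily small e would contain a whole upper left quadrant near p and
      so overlap the interior of the tilted tile.  Hence they are not covered.

    - In every tiling of a rectangle by six parallel rectangles
      ([axis_tiling_obstruction]) either two tiles have the same projection on
      one of the axes, or four tiles A, B, C, D form a frame: they contain the
      four corners of a rectangle, and each side of that rectangle is the union
      of the sides of the two tiles at its ends.  The frame is for instance the
      outline of a pinwheel.  The property depends only on the order of the
      coordinates.  Replacing each coordinate by the number of tiles whose left
      (or lower) end is smaller turns the tiling into a tiling of the 6 by 6
      grid, and these are examined exhaustively ([search_succeeds]).

    - In a frame of four tiles of equal area, opposite tiles are congruent
      ([frame_opposite_widths]).  If W and H are the sides of the framed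
      rectangle and al is the common area, eliminating all unknowns but the
      width w of A gives (W H - 2 al) (H w (W - w) - al W) = 0.  The first
      factor is nonzero, and the second determines the width of C to be w.

    Every case thus yields two congruent tiles. *)

(** * Tilings of the 6 by 6 grid by six rectangles *)

(** A tile of the grid is a pair of intervals [(left, right)] and
    [(bottom, top)]; it consists of the cells [(a, b)] with
    [left <= a < right] and [bottom <= b < top]. *)
Notation tile := ((nat * nat) * (nat * nat))%type.

Definition inb (a : nat) (I : nat * nat) : bool :=
  (fst I <=? a)%nat && (a <? snd I)%nat.

Definition coversb (c : nat * nat) (p : tile) : bool :=
  inb (fst c) (fst p) && inb (snd c) (snd p).

Definition apart (I J : nat * nat) : bool :=
  (snd I <=? fst J)%nat || (snd J <=? fst I)%nat.

Definition disjointb (p q : tile) : bool :=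
  apart (fst p) (fst q) || apart (snd p) (snd q).

(** The nonempty intervals with end points in [0 .. 6]. *)
Definition intervals : list (nat * nat) :=
  flat_map (fun a => map (fun b => (a, b)) (seq (S a) (6 - a))) (seq 0 6).

(** The tiles of the grid that cover the cell [c]. *)
Definition tiles_over (c : nat * nat) : list tile :=
  list_prod (filter (inb (fst c)) intervals) (filter (inb (snd c)) intervals).

Definition cells : list (nat * nat) := list_prod (seq 0 6) (seq 0 6).

Definition interval_eqb (I J : nat * nat) : bool :=
  (fst I =? fst J)%nat && (snd I =? snd J)%nat.

Definition clashb (p q : tile) : bool :=
  interval_eqb (fst p) (fst q) || interval_eqb (snd p) (snd q).

(** [A], [B], [C], [D] are the lower left, lower right, upper right and upper
    left tiles of a frame: their outer sides line up in pairs, and along each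
    side of the frame the two tiles meet end to end. *)
Definition frameb (A B C D : tile) : bool :=
  (fst (fst A) =? fst (fst D))%nat && (snd (fst A) =? fst (fst B))%nat &&
  (snd (fst D) =? fst (fst C))%nat && (snd (fst B) =? snd (fst C))%nat &&
  (fst (snd A) =? fst (snd B))%nat && (snd (snd A) =? fst (snd D))%nat &&
  (snd (snd B) =? fst (snd C))%nat && (snd (snd D) =? snd (snd C))%nat.

Definition has_frame (l : list tile) : bool :=
  existsb (fun A => existsb (fun B => existsb (fun C =>
    existsb (frameb A B C) l) l) l) l.

(** Only the tile placed last, at the head of the list, is compared with the
    others. *)
Definition has_clash (l : list tile) : bool :=
  match l with [] => false | p :: q => existsb (clashb p) q end.

(** The number of intervals of [l] whose left end is smaller than [v]. *)
Definition below (l : list (nat * nat)) (v : nat) : nat :=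
  length (filter (fun J => (fst J <? v)%nat) l).

(** Every end point equals the number of smaller left ends.  This normalises the
    coordinates of a tiling, and removes most of the search tree. *)
Definition ranked (l : list (nat * nat)) : Prop :=
  forall I, In I l -> below l (fst I) = fst I /\ below l (snd I) = snd I.

(** What [ranked] imposes on a part [l] of a list from which [rem] intervals are
    still missing. *)
Definition nearly_rankedb (rem : nat) (l : list (nat * nat)) : bool :=
  forallb (fun I => forallb (fun v =>
    (below l v <=? v)%nat && (v <=? below l v + rem)%nat) [fst I; snd I]) l.

Definition prunable (rem : nat) (l : list tile) : bool :=
  has_clash l ||
  negb (nearly_rankedb rem (map fst l) && nearly_rankedb rem (map snd l)).

(** Extends the partial tiling [placed] by [fuel] tiles, always covering the
    first free cell.  The result is [true] when every tiling of the grid reached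
    in this way, with [ranked] coordinates and no two tiles of equal projection,
    has a frame.  When tiles remain but no cell is free, or the converse, there
    is nothing to check. *)
Fixpoint search (fuel : nat) (placed : list tile) : bool :=
  if prunable fuel placed then true else
  match find (fun c => negb (existsb (coversb c) placed)) cells with
  | None => match fuel with O => has_frame placed | S _ => true end
  | Some c =>
      match fuel with
      | O => true
      | S f =>
          forallb (fun p => search f (p :: placed))
            (filter (fun p => forallb (disjointb p) placed) (tiles_over c))
      end
  end.

Lemma search_succeeds : search 6 [] = true.
Proof. vm_cast_no_check (eq_refl true). Qed.

Lemma inb_spec a I : inb a I = true <-> (fst I <= a < snd I)%nat.
Proof. unfold inb. rewrite andb_true_iff, Nat.leb_le, Nat.ltb_lt. lia. Qed.

Lemma intervals_spec I : In I intervals <-> (fst I < snd I <= 6)%nat.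
Proof.
  destruct I as [a b]; unfold intervals; rewrite in_flat_map; simpl fst; simpl snd.
  split.
  - intros [x [Hx Hm]]. apply in_map_iff in Hm as [y [E Hy]].
    injection E as -> ->. apply in_seq in Hx, Hy. lia.
  - intros H. exists a. split; [apply in_seq; lia|].
    apply in_map_iff. exists b. split; [reflexivity|apply in_seq; lia].
Qed.

Lemma below_perm l l' v : Permutation l l' -> below l v = below l' v.
Proof.
  unfold below; induction 1; simpl; repeat (destruct (_ <? v)%nat; simpl); lia.
Qed.

Lemma below_app l l' v : below (l ++ l') v = (below l v + below l' v)%nat.
Proof. unfold below. now rewrite filter_app, length_app. Qed.

Lemma ranked_nearly l rest whole :
  Permutation whole (l ++ rest) -> ranked whole ->
  nearly_rankedb (length rest) l = true.
Proof.
  intros Hp Hr. apply forallb_forall; intros I HI.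
  assert (Hw : In I whole).
  { apply (Permutation_in _ (Permutation_sym Hp)), in_or_app; now left. }
  assert (key : forall v, below whole v = v ->
    (below l v <=? v)%nat && (v <=? below l v + length rest)%nat = true).
  { intros v Hv. rewrite (below_perm _ _ v Hp), below_app in Hv.
    pose proof (filter_length_le (fun J : nat * nat => (fst J <? v)%nat) rest) as Hle.
    fold (below rest v) in Hle.
    rewrite andb_true_iff, !Nat.leb_le. lia. }
  destruct (Hr I Hw) as [H1 H2]. simpl.
  now rewrite (key _ H1), (key _ H2).
Qed.

Definition same_side (p q : tile) : Prop := fst p = fst q \/ snd p = snd q.

Lemma clashb_spec p q : clashb p q = true -> same_side p q.
Proof.
  unfold clashb, interval_eqb, same_side; destruct p as [[] []], q as [[] []]; simpl.
  rewrite orb_true_iff, !andb_true_iff, !Nat.eqb_eq.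
  intros [[-> ->]|[-> ->]]; auto.
Qed.

(** The tiles of [ts] are nonempty, lie in the 6 by 6 grid, and cover each of
    its cells exactly once. *)
Definition grid_tiling (ts : list tile) : Prop :=
  NoDup ts /\
  (forall p, In p ts -> (fst (fst p) < snd (fst p) <= 6)%nat /\
                        (fst (snd p) < snd (snd p) <= 6)%nat) /\
  (forall p q, In p ts -> In q ts -> p <> q -> disjointb p q = true) /\
  (forall c, In c cells -> exists p, In p ts /\ coversb c p = true).

Definition has_same_side (ts : list tile) : Prop :=
  exists p q, In p ts /\ In q ts /\ p <> q /\ same_side p q.

Definition has_frame_in (ts : list tile) : Prop :=
  exists A B C D, In A ts /\ In B ts /\ In C ts /\ In D ts /\
    frameb A B C D = true.

Lemma prunable_sound (ts placed rest : list tile) :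
  NoDup ts -> ranked (map fst ts) -> ranked (map snd ts) ->
  Permutation ts (placed ++ rest) ->
  prunable (length rest) placed = true -> has_same_side ts.
Proof.
  intros Hnd Hr1 Hr2 Hp Hpr.
  apply orb_true_iff in Hpr as [Hc|Hc].
  - destruct placed as [|p q]; [discriminate|].
    apply existsb_exists in Hc as [x [Hx Hc]].
    pose proof (Permutation_NoDup Hp Hnd) as Hnd'.
    apply Permutation_sym in Hp.
    exists p, x. repeat split.
    + apply (Permutation_in _ Hp); now left.
    + apply (Permutation_in _ Hp); right. apply in_or_app; now left.
    + intros ->. simpl in Hnd'. inversion Hnd' as [|? ? Hn]; subst.
      apply Hn, in_or_app; now left.
    + now apply clashb_spec.
  - exfalso.
    assert (E : forall f : tile -> nat * nat, ranked (map f ts) ->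
              nearly_rankedb (length rest) (map f placed) = true).
    { intros f Hf.
      replace (length rest) with (length (map f rest)) by apply length_map.
      apply ranked_nearly with (2 := Hf).
      rewrite <- map_app. now apply Permutation_map. }
    rewrite (E fst Hr1), (E snd Hr2) in Hc. discriminate.
Qed.

Lemma disjoint_not_covers c p q :
  disjointb p q = true -> coversb c p = true -> coversb c q = true -> False.
Proof.
  unfold disjointb, apart, coversb.
  rewrite !orb_true_iff, !andb_true_iff, !inb_spec, !Nat.leb_le. lia.
Qed.

(** The tiles [rest] are those of the tiling [ts] that are not yet placed. *)
Lemma search_sound (ts : list tile) :
  grid_tiling ts -> ranked (map fst ts) -> ranked (map snd ts) ->
  forall (fuel : nat) (placed rest : list tile),
  Permutation ts (placed ++ rest) -> length rest = fuel ->
  search fuel placed = true -> has_same_side ts \/ has_frame_in ts.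
Proof.
  intros (Hnd & Hwf & Hdis & Hcov) Hr1 Hr2.
  induction fuel as [|fuel IH]; intros placed rest Hp Hlen Hs;
  assert (Hin : forall p, In p placed \/ In p rest <-> In p ts)
    by (intros p; rewrite <- in_app_iff; split; apply Permutation_in;
        [apply Permutation_sym|]; exact Hp);
  assert (Hnd' : NoDup (placed ++ rest)) by exact (Permutation_NoDup Hp Hnd);
  cbn [search] in Hs; destruct (prunable _ placed) eqn:Hpr;
  try (left; apply (prunable_sound ts placed rest Hnd Hr1 Hr2 Hp);
       rewrite Hlen; exact Hpr);
  destruct (find _ cells) as [c|] eqn:Hf.
  - exfalso. apply find_some in Hf as [Hc Hf].
    destruct (Hcov c Hc) as [p [Hpt Hpc]].
    destruct rest; [|discriminate].
    apply Hin in Hpt as [Hpt|[]].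
    apply negb_true_iff in Hf.
    rewrite (proj2 (existsb_exists _ _)) in Hf; [discriminate|eauto].
  - right. unfold has_frame in Hs.
    apply existsb_exists in Hs as [A [HA Hs]].
    apply existsb_exists in Hs as [B [HB Hs]].
    apply existsb_exists in Hs as [C [HC Hs]].
    apply existsb_exists in Hs as [D [HD Hs]].
    exists A, B, C, D. repeat split; try assumption; apply Hin; now left.
  - apply find_some in Hf as [Hc Hf].
    destruct (Hcov c Hc) as [p [Hpt Hpc]].
    apply negb_true_iff in Hf.
    assert (Hpn : ~ In p placed).
    { intros Hpp.
      rewrite (proj2 (existsb_exists _ _)) in Hf; [discriminate|eauto]. }
    assert (Hpr' : In p rest) by (apply Hin in Hpt; tauto).
    apply in_split in Hpr' as [r1 [r2 ->]].
    apply (IH (p :: placed) (r1 ++ r2)).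
    + rewrite Hp. simpl. rewrite !app_assoc. symmetry.
      apply Permutation_middle.
    + rewrite length_app in *; simpl in Hlen; lia.
    + rewrite forallb_forall in Hs. apply Hs, filter_In. split.
      * destruct p as [I J]. apply in_prod; apply filter_In;
        rewrite intervals_spec;
        destruct (Hwf _ Hpt); apply andb_true_iff in Hpc; tauto.
      * apply forallb_forall; intros q Hq. apply Hdis; auto.
        -- apply Hin; now left.
        -- intros ->; contradiction.
  - (* a tile not yet placed would have nowhere to go *)
    exfalso. destruct rest as [|q rest]; [discriminate|].
    assert (Hq : In q ts) by (apply Hin; right; now left).
    set (c := (fst (fst q), fst (snd q))).
    assert (Hqc : coversb c q = true).
    { destruct (Hwf q Hq). unfold coversb. rewrite andb_true_iff, !inb_spec.
      simpl. lia. }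
    assert (Hc : In c cells).
    { destruct (Hwf q Hq). apply in_prod; apply in_seq; lia. }
    pose proof (find_none _ _ Hf c Hc) as Hn. simpl in Hn.
    apply negb_false_iff, existsb_exists in Hn as [p [Hpp Hpc]].
    apply (disjoint_not_covers c p q); auto.
    apply Hdis; auto; [apply Hin; now left|].
    intros ->. apply NoDup_remove_2 in Hnd'. apply Hnd', in_or_app; now left.
Qed.

Theorem grid_tiling_obstruction (ts : list tile) :
  length ts = 6%nat -> grid_tiling ts ->
  ranked (map fst ts) -> ranked (map snd ts) ->
  has_same_side ts \/ has_frame_in ts.
Proof.
  intros Hl Ht Hr1 Hr2.
  apply (search_sound ts Ht Hr1 Hr2 6 [] ts);
    [reflexivity|exact Hl|exact search_succeeds].
Qed.

(** * Ranks of real numbers *)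

(** The number of entries of [V], with multiplicity, that are smaller than
    [y]. *)
Definition rank (V : list R) (y : R) : nat :=
  length (filter (fun v => if Rlt_dec v y then true else false) V).

Lemma rank_cons v V y :
  rank (v :: V) y = ((if Rlt_dec v y then 1 else 0) + rank V y)%nat.
Proof. unfold rank; simpl. destruct (Rlt_dec v y); reflexivity. Qed.

Lemma rank_perm V V' y : Permutation V V' -> rank V y = rank V' y.
Proof. induction 1; rewrite ?rank_cons; lia. Qed.

Lemma rank_le V x y : x <= y -> (rank V x <= rank V y)%nat.
Proof.
  intros H; induction V as [|v V IH]; [apply le_n|].
  rewrite !rank_cons. destruct (Rlt_dec v x), (Rlt_dec v y); lia || lra.
Qed.

Lemma rank_lt V x y : In x V -> x < y -> (rank V x < rank V y)%nat.
Proof.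
  intros Hin H; induction V as [|v V IH]; [destruct Hin|].
  pose proof (rank_le V x y (Rlt_le _ _ H)).
  rewrite !rank_cons. destruct Hin as [->|Hin].
  - destruct (Rlt_dec x x), (Rlt_dec x y); lia || lra.
  - specialize (IH Hin). destruct (Rlt_dec v x), (Rlt_dec v y); lia || lra.
Qed.

Lemma rank_lt_iff V x y : In x V -> (rank V x < rank V y)%nat <-> x < y.
Proof.
  intros Hin; split; [|now apply rank_lt].
  intros H. destruct (Rlt_le_dec x y) as [|Hle]; [assumption|].
  apply (rank_le V) in Hle. lia.
Qed.

Lemma rank_le_length V y : (rank V y <= length V)%nat.
Proof. apply filter_length_le. Qed.

Module ROrder <: TotalLeBool.
  Definition t := R.
  Definition leb (x y : R) : bool := if Rle_lt_dec x y then true else false.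
  Lemma leb_total x y : leb x y = true \/ leb y x = true.
  Proof.
    unfold leb. destruct (Rle_lt_dec x y), (Rle_lt_dec y x); auto; lra.
  Qed.
End ROrder.

Module RSort := Sort ROrder.

Lemma sorted_order_statistic V :
  StronglySorted (fun x y => ROrder.leb x y = true) V ->
  forall a, (a < length V)%nat ->
  exists x, In x V /\ forall y, (a < rank V y)%nat <-> x < y.
Proof.
  assert (leb_le : forall x y, ROrder.leb x y = true -> x <= y).
  { intros x y; unfold ROrder.leb. now destruct (Rle_lt_dec x y). }
  induction 1 as [|h V Hs IH Hh]; simpl; intros a Ha; [lia|].
  rewrite Forall_forall in Hh.
  destruct a as [|a].
  - exists h. split; [now left|]. intros y. rewrite rank_cons.
    destruct (Rlt_dec h y) as [Hy|Hy]; [split; [trivial|lia]|].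
    split; [|contradiction]. intros H0.
    destruct (rank V y) eqn:E; [lia|]. exfalso.
    unfold rank in E.
    destruct (filter _ V) as [|v l] eqn:Ef; [discriminate|].
    assert (Hv : In v (v :: l)) by now left.
    rewrite <- Ef in Hv. apply filter_In in Hv as [Hv Hl].
    apply Hh, leb_le in Hv. destruct (Rlt_dec v y); [lra|discriminate].
  - destruct (IH a) as [x [Hx Hr]]; [lia|].
    exists x; split; [now right|]. intros y.
    specialize (leb_le _ _ (Hh x Hx)).
    rewrite rank_cons, <- Hr.
    destruct (Rlt_dec h y) as [Hy|Hy]; [lia|].
    split; [lia|]. intros H. apply Hr in H. lra.
Qed.

(** [x] is the entry of index [a] of [V] in increasing order, counted from 0. *)
Lemma order_statistic V a :
  (a < length V)%nat ->
  exists x, In x V /\ forall y, (a < rank V y)%nat <-> x < y.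
Proof.
  intros Ha.
  pose proof (RSort.Permuted_sort V) as Hp.
  destruct (sorted_order_statistic (RSort.sort V)) with (a := a) as [x [Hx Hr]].
  - apply RSort.StronglySorted_sort.
    intros x y z. unfold is_true, ROrder.leb.
    destruct (Rle_lt_dec x y), (Rle_lt_dec y z), (Rle_lt_dec x z);
      auto; discriminate || lra.
  - now rewrite <- (Permutation_length Hp).
  - exists x. split; [now apply (Permutation_in _ (Permutation_sym Hp))|].
    intros y. now rewrite (rank_perm V _ y Hp).
Qed.

(** * Four tiles of equal area forming a frame *)

(** The tiles 1, 2, 3, 4 are the lower left, lower right, upper right and upper
    left tiles of the frame. *)
Lemma frame_opposite_widths W H al w1 h1 w2 h2 w3 h3 w4 h4 :
  0 < w1 -> 0 < h1 -> 0 < w2 -> 0 < h2 -> 0 < w3 -> 0 < h3 -> 0 < w4 -> 0 < h4 ->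
  w1 + w2 = W -> w4 + w3 = W -> h1 + h4 = H -> h2 + h3 = H ->
  w1 * h1 = al -> w2 * h2 = al -> w3 * h3 = al -> w4 * h4 = al ->
  w1 = w3.
Proof.
  intros P1 Q1 P2 Q2 P3 Q3 P4 Q4 E1 E2 E3 E4 A1 A2 A3 A4.
  assert (Hne : W * H <> 2 * al).
  { intros E.
    (* tiles 1 and 4 would each be higher than half the rectangle *)
    assert (H < 2 * h1) by (apply Rmult_lt_reg_l with W; nra).
    assert (H < 2 * h4) by (apply Rmult_lt_reg_l with W; nra).
    lra. }
  assert (G3 : w3 * (H * w2 - al) = al * w2).
  { rewrite <- E4. replace (w3 * ((h2 + h3) * w2 - al))
      with (w3 * (w2 * h2) + w3 * h3 * w2 - w3 * al) by ring.
    rewrite A2, A3. ring. }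
  assert (G4 : w4 * (H * w1 - al) = al * w1).
  { rewrite <- E3. replace (w4 * ((h1 + h4) * w1 - al))
      with (w4 * (w1 * h1) + w4 * h4 * w1 - w4 * al) by ring.
    rewrite A1, A4. ring. }
  (* the sum w3 + w4 = W, with w3 and w4 expressed through w1 and w2 *)
  assert (F : (W * H - 2 * al) * (H * w1 * w2 - al * W) = 0).
  { assert (G : W * ((H * w2 - al) * (H * w1 - al)) =
      al * w2 * (H * w1 - al) + al * w1 * (H * w2 - al)).
    { rewrite <- G3, <- G4, <- E2. ring. }
    rewrite <- E1 in *. lra. }
  apply Rmult_integral in F as [F|F]; [lra|].
  assert (Hal : al * (w1 + w2) = al * W) by now rewrite E1.
  assert (Hp : 0 < w2 * h3) by now apply Rmult_lt_0_compat.
  assert (H * w2 - al = w2 * h3) by (rewrite <- A2, <- E4; ring).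
  apply Rmult_eq_reg_r with (H * w2 - al); lra.
Qed.

(** * Axis-parallel tilings *)

(** The six rectangles [l k, r k] x [b k, t k] tile [0, W] x [0, H].  The
    covering condition is stated for half-open rectangles, so that each point
    has a single owner. *)
Definition axis_tiling (W H : R) (l r b t : nat -> R) : Prop :=
  (forall i, (i < 6)%nat -> 0 <= l i < r i /\ r i <= W /\ 0 <= b i < t i /\ t i <= H) /\
  (forall i j, (i < 6)%nat -> (j < 6)%nat -> i <> j ->
     r i <= l j \/ r j <= l i \/ t i <= b j \/ t j <= b i) /\
  (forall x y, 0 <= x < W -> 0 <= y < H ->
     exists k, (k < 6)%nat /\ l k <= x < r k /\ b k <= y < t k).

Lemma axis_tiling_transpose W H l r b t :
  axis_tiling W H l r b t -> axis_tiling H W b t l r.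
Proof.
  intros (H1 & H2 & H3). split; [|split].
  - intros i Hi. specialize (H1 i Hi). tauto.
  - intros i j Hi Hj Hij. specialize (H2 i j Hi Hj Hij). tauto.
  - intros x y Hx Hy. destruct (H3 y x Hy Hx) as [k Hk]. exists k. tauto.
Qed.

(** The tile owning the point [(r i, b i)] starts at abscissa [r i]. *)
Lemma right_end W H l r b t i :
  axis_tiling W H l r b t -> (i < 6)%nat ->
  r i = W \/ exists j, (j < 6)%nat /\ l j = r i.
Proof.
  intros (H1 & H2 & H3) Hi.
  destruct (H1 i Hi) as (Hl & Hr & Hb & Ht).
  destruct (Req_dec (r i) W) as [|Hne]; [now left|right].
  destruct (H3 (r i) (b i)) as [k (Hk & Hx & Hy)]; [lra|lra|].
  exists k. split; [assumption|].
  destruct (Req_dec (l k) (r i)) as [|Hlt]; [assumption|exfalso].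
  assert (Hki : k <> i) by (intros ->; lra).
  specialize (H2 k i Hk Hi Hki). specialize (H1 k Hk). lra.
Qed.

Definition left_ends (l : nat -> R) : list R := map l (seq 0 6).

Lemma in_left_ends l x : In x (left_ends l) <-> exists k, (k < 6)%nat /\ l k = x.
Proof.
  unfold left_ends. rewrite in_map_iff.
  split; intros [k [H1 H2]]; exists k; rewrite in_seq in *; split; auto; lia.
Qed.

Lemma in_left_ends_intro l k : (k < 6)%nat -> In (l k) (left_ends l).
Proof. intros Hk. apply in_left_ends. eauto. Qed.

(** The interval [l k, r k] in rank coordinates. *)
Definition rank_interval (l r : nat -> R) (k : nat) : nat * nat :=
  (rank (left_ends l) (l k), rank (left_ends l) (r k)).

Lemma rank_interval_ranked l r : ranked (map (rank_interval l r) (seq 0 6)).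
Proof.
  assert (E : forall y, below (map (rank_interval l r) (seq 0 6))
                          (rank (left_ends l) y) = rank (left_ends l) y).
  { intros y. unfold rank at 2. unfold left_ends at 2.
    assert (Hs : forall k, In k (seq 0 6) -> In (l k) (left_ends l)).
    { intros k Hk. apply in_map, Hk. }
    revert Hs. generalize (seq 0 6). unfold below.
    intros s; induction s as [|k s IH]; intros Hs; [reflexivity|].
    cbn [map filter rank_interval fst].
    specialize (IH (fun k Hk => Hs k (or_intror Hk))).
    pose proof (rank_lt_iff (left_ends l) (l k) y (Hs k (or_introl eq_refl))) as Hk.
    unfold rank_interval at 1. cbn [fst].
    destruct (Nat.ltb_spec (rank (left_ends l) (l k)) (rank (left_ends l) y)) as [Hb|Hb],
      (Rlt_dec (l k) y) as [Hy|Hy]; cbn [length].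
    - now rewrite IH.
    - now apply Hk in Hb.
    - apply Hk in Hy. lia.
    - exact IH. }
  intros I HI. apply in_map_iff in HI as [k [<- _]]. split; apply E.
Qed.

(** Ranks separate the right ends of tiles as well as their left ends, since a
    right end is either a left end or [W]. *)
Lemma rank_end_inj l W y z :
  (forall k, (k < 6)%nat -> l k < W) ->
  (y = W \/ exists k, (k < 6)%nat /\ l k = y) ->
  (z = W \/ exists k, (k < 6)%nat /\ l k = z) ->
  rank (left_ends l) y = rank (left_ends l) z -> y = z.
Proof.
  intros Hl.
  assert (key : forall y z, (y = W \/ exists k, (k < 6)%nat /\ l k = y) ->
    (z = W \/ exists k, (k < 6)%nat /\ l k = z) ->
    y < z -> (rank (left_ends l) y < rank (left_ends l) z)%nat).
  { intros u v Hu Hv Huv. apply rank_lt; [|assumption].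
    apply in_left_ends. destruct Hu as [->|Hu]; [|assumption].
    destruct Hv as [->|[k [Hk <-]]]; [lra|]. specialize (Hl k Hk). lra. }
  intros Hy Hz E. destruct (Rtotal_order y z) as [Hlt|[|Hlt]]; [|assumption|];
    apply key in Hlt; auto; lia.
Qed.

Lemma axis_tiling_obstruction W H l r b t :
  axis_tiling W H l r b t ->
  (exists i j, (i < 6)%nat /\ (j < 6)%nat /\ i <> j /\
     ((l i = l j /\ r i = r j) \/ (b i = b j /\ t i = t j))) \/
  (exists i j k m, ((i < 6)%nat /\ (j < 6)%nat /\ (k < 6)%nat /\ (m < 6)%nat) /\
     (l i = l m /\ r i = l j /\ r m = l k /\ r j = r k) /\
     (b i = b j /\ t i = b m /\ t j = b k /\ t m = t k)).
Proof.
  intros Ht. pose proof (axis_tiling_transpose _ _ _ _ _ _ Ht) as Ht'.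
  pose proof (fun i => right_end _ _ _ _ _ _ i Ht) as Hr.
  pose proof (fun i => right_end _ _ _ _ _ _ i Ht') as Hrt.
  destruct Ht as (H1 & H2 & H3).
  set (f := fun k => (rank_interval l r k, rank_interval b t k)).
  assert (HlW : forall k, (k < 6)%nat -> l k < W) by (intros k Hk; specialize (H1 k Hk); lra).
  assert (HbH : forall k, (k < 6)%nat -> b k < H) by (intros k Hk; specialize (H1 k Hk); lra).
  assert (Hin : forall p, In p (map f (seq 0 6)) <-> exists k, (k < 6)%nat /\ p = f k).
  { intros p. rewrite in_map_iff. split; intros [k [Hk Hk']]; exists k;
      rewrite in_seq in *; split; auto; lia. }
  assert (Hdis : forall i j, (i < 6)%nat -> (j < 6)%nat -> i <> j ->
            disjointb (f i) (f j) = true).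
  { intros i j Hi Hj Hij. unfold disjointb, apart, f, rank_interval. cbn [fst snd].
    rewrite !orb_true_iff, !Nat.leb_le.
    destruct (H2 i j Hi Hj Hij) as [Hc|[Hc|[Hc|Hc]]].
    - left; left. now apply rank_le.
    - left; right. now apply rank_le.
    - right; left. now apply rank_le.
    - right; right. now apply rank_le. }
  assert (Hwf : forall k, (k < 6)%nat ->
    (fst (fst (f k)) < snd (fst (f k)) <= 6)%nat /\
    (fst (snd (f k)) < snd (snd (f k)) <= 6)%nat).
  { intros k Hk. specialize (H1 k Hk). unfold f, rank_interval; cbn [fst snd].
    repeat split; try apply rank_le_length;
      (apply rank_lt; [now apply in_left_ends_intro|lra]). }
  assert (Hinj : forall i j, (i < 6)%nat -> (j < 6)%nat -> f i = f j -> i = j).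
  { intros i j Hi Hj E. destruct (Nat.eq_dec i j) as [|Hij]; [assumption|exfalso].
    specialize (Hdis i j Hi Hj Hij). rewrite <- E in Hdis.
    specialize (Hwf i Hi). unfold disjointb, apart in Hdis.
    rewrite !orb_true_iff, !Nat.leb_le in Hdis. lia. }
  assert (Hgrid : grid_tiling (map f (seq 0 6))).
  { split; [|split; [|split]].
    - apply NoDup_map_NoDup_ForallPairs; [|apply seq_NoDup].
      intros i j Hi Hj. apply in_seq in Hi, Hj. apply Hinj; lia.
    - intros p Hp. apply Hin in Hp as [k [Hk ->]]. now apply Hwf.
    - intros p q Hp Hq Hpq.
      apply Hin in Hp as [i [Hi ->]]. apply Hin in Hq as [j [Hj ->]].
      apply Hdis; trivial. congruence.
    - intros [a c] Hc. apply in_prod_iff in Hc as [Ha Hc].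
      apply in_seq in Ha, Hc.
      destruct (order_statistic (left_ends l) a) as [x [Hx Hxr]]; [simpl; lia|].
      destruct (order_statistic (left_ends b) c) as [y [Hy Hyr]]; [simpl; lia|].
      apply in_left_ends in Hx as [i [Hi <-]].
      apply in_left_ends in Hy as [j [Hj <-]].
      pose proof (H1 i Hi). pose proof (H1 j Hj).
      destruct (H3 (l i) (b j)) as [k (Hk & Hkx & Hky)]; [lra|lra|].
      exists (f k). split; [apply Hin; eauto|].
      unfold coversb, f, rank_interval. rewrite andb_true_iff, !inb_spec.
      cbn [fst snd].
      repeat split.
      + apply Nat.nlt_ge. rewrite Hxr. lra.
      + apply Hxr. lra.
      + apply Nat.nlt_ge. rewrite Hyr. lra.
      + apply Hyr. lra. }
  assert (Ex : forall u v, rank (left_ends l) u = rank (left_ends l) v ->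
    (u = W \/ exists k, (k < 6)%nat /\ l k = u) ->
    (v = W \/ exists k, (k < 6)%nat /\ l k = v) -> u = v).
  { intros. now apply (rank_end_inj l W). }
  assert (Ey : forall u v, rank (left_ends b) u = rank (left_ends b) v ->
    (u = H \/ exists k, (k < 6)%nat /\ b k = u) ->
    (v = H \/ exists k, (k < 6)%nat /\ b k = v) -> u = v).
  { intros. now apply (rank_end_inj b H). }
  destruct (grid_tiling_obstruction (map f (seq 0 6))) as [Hs|Hf].
  - now rewrite length_map, length_seq.
  - exact Hgrid.
  - rewrite map_map. apply rank_interval_ranked.
  - rewrite map_map. apply rank_interval_ranked.
  - left. destruct Hs as (p & q & Hp & Hq & Hpq & Hs).
    apply Hin in Hp as [i [Hi ->]]. apply Hin in Hq as [j [Hj ->]].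
    exists i, j. split; [exact Hi|split; [exact Hj|split; [congruence|]]].
    destruct Hs as [Hs|Hs]; [left|right];
      unfold f, rank_interval in Hs; cbn [fst snd] in Hs;
      injection Hs as Hs1 Hs2.
    + split; apply Ex; eauto.
    + split; apply Ey; eauto.
  - right. destruct Hf as (p & q & s & u & Hp & Hq & Hs & Hu & Hf).
    apply Hin in Hp as [i [Hi ->]]. apply Hin in Hq as [j [Hj ->]].
    apply Hin in Hs as [k [Hk ->]]. apply Hin in Hu as [m [Hm ->]].
    exists i, j, k, m. split; [auto|].
    unfold frameb, f, rank_interval in Hf. cbn [fst snd] in Hf.
    rewrite !andb_true_iff, !Nat.eqb_eq in Hf.
    decompose [and] Hf.
    split; [repeat split; apply Ex|repeat split; apply Ey]; eauto.
Qed.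

(** * Tiles in the frame of the tiled rectangle *)

(** A rectangle in coordinates: the vertex [(corner_x, corner_y)], the direction
    [(dir_x, dir_y)] of the side of length [len1], and the length [len2] of the
    side obtained by a quarter turn. *)
Record box : Type := Box {
  corner_x : R; corner_y : R; dir_x : R; dir_y : R; len1 : R; len2 : R
}.

(** The coordinates of the point [(a, b)] in the frame of [B]. *)
Definition coord1 (B : box) (a b : R) : R :=
  (a - corner_x B) * dir_x B + (b - corner_y B) * dir_y B.
Definition coord2 (B : box) (a b : R) : R :=
  (b - corner_y B) * dir_x B - (a - corner_x B) * dir_y B.

Definition in_box (B : box) (a b : R) : Prop :=
  0 <= coord1 B a b <= len1 B /\ 0 <= coord2 B a b <= len2 B.

Definition in_open_box (B : box) (a b : R) : Prop :=
  0 < coord1 B a b < len1 B /\ 0 < coord2 B a b < len2 B.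

(** The direction is a unit vector with angle in [0, pi / 2), so that the box is
    parallel to the axes exactly when [dir_y B = 0], and its lowest vertex is
    the corner when [dir_y B > 0]. *)
Definition normal_box (B : box) : Prop :=
  0 < dir_x B /\ 0 <= dir_y B /\ dir_x B ^ 2 + dir_y B ^ 2 = 1 /\ 0 < len1 B /\ 0 < len2 B.

(** [B] is the rectangle [r] seen in the frame of [S]; its two lengths are the
    sides of [r] in some order. *)
Definition represents (S r : rectangle) (B : box) : Prop :=
  normal_box B /\
  ((len1 B = width r /\ len2 B = height r) \/ (len1 B = height r /\ len2 B = width r)) /\
  forall a b, (in_rectangle r (frame_point S a b) <-> in_box B a b) /\
              (in_interior r (frame_point S a b) <-> in_open_box B a b).

Lemma frame_point_coords r px py s t :
  (px, py) = frame_point r s t <->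
  s = (px - vx r) * ux r + (py - vy r) * uy r /\
  t = (py - vy r) * ux r - (px - vx r) * uy r.
Proof.
  pose proof (u_unit r) as Hu. unfold frame_point. split.
  - intros E. injection E as -> ->. split.
    + transitivity (s * (ux r ^ 2 + uy r ^ 2)); [rewrite Hu|]; ring.
    + transitivity (t * (ux r ^ 2 + uy r ^ 2)); [rewrite Hu|]; ring.
  - intros [-> ->]. f_equal.
    + transitivity (vx r + (px - vx r) * (ux r ^ 2 + uy r ^ 2)); [rewrite Hu|]; ring.
    + transitivity (vy r + (py - vy r) * (ux r ^ 2 + uy r ^ 2)); [rewrite Hu|]; ring.
Qed.

Lemma in_rectangle_coords r px py :
  in_rectangle r (px, py) <->
  0 <= (px - vx r) * ux r + (py - vy r) * uy r <= width r /\
  0 <= (py - vy r) * ux r - (px - vx r) * uy r <= height r.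
Proof.
  unfold in_rectangle. split.
  - intros (s & t & Hs & Ht & E). apply frame_point_coords in E as [<- <-]. auto.
  - intros [Hs Ht]. do 2 eexists. split; [exact Hs|split; [exact Ht|]].
    now apply frame_point_coords.
Qed.

Lemma in_interior_coords r px py :
  in_interior r (px, py) <->
  0 < (px - vx r) * ux r + (py - vy r) * uy r < width r /\
  0 < (py - vy r) * ux r - (px - vx r) * uy r < height r.
Proof.
  unfold in_interior. split.
  - intros (s & t & Hs & Ht & E). apply frame_point_coords in E as [<- <-]. auto.
  - intros [Hs Ht]. do 2 eexists. split; [exact Hs|split; [exact Ht|]].
    now apply frame_point_coords.
Qed.

(** Any rectangle has a normal box: choose as corner the right one of its four
    vertices.  The construction is informative, so that it defines a function of
    the tile. *)
Lemma represented (S r : rectangle) : { B : box | represents S r B }.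
Proof.
  pose (c := ux r * ux S + uy r * uy S).
  pose (s := uy r * ux S - ux r * uy S).
  pose (x := (vx r - vx S) * ux S + (vy r - vy S) * uy S).
  pose (y := (vy r - vy S) * ux S - (vx r - vx S) * uy S).
  pose proof (u_unit S) as HS. pose proof (u_unit r) as Hr.
  pose proof (width_pos r) as Hw. pose proof (height_pos r) as Hh.
  assert (Hcs : c ^ 2 + s ^ 2 = 1).
  { transitivity ((ux r ^ 2 + uy r ^ 2) * (ux S ^ 2 + uy S ^ 2));
      [unfold c, s; ring|rewrite HS, Hr; ring]. }
  assert (Hcoord : forall a b, exists px py, frame_point S a b = (px, py) /\
    (px - vx r) * ux r + (py - vy r) * uy r = (a - x) * c + (b - y) * s /\
    (py - vy r) * ux r - (px - vx r) * uy r = (b - y) * c - (a - x) * s).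
  { intros a b. exists (vx S + a * ux S - b * uy S), (vy S + a * uy S + b * ux S).
    split; [reflexivity|].
    assert (Ex : x * ux S - y * uy S = vx r - vx S).
    { transitivity ((vx r - vx S) * (ux S ^ 2 + uy S ^ 2));
        [unfold x, y; ring|rewrite HS; ring]. }
    assert (Ey : x * uy S + y * ux S = vy r - vy S).
    { transitivity ((vy r - vy S) * (ux S ^ 2 + uy S ^ 2));
        [unfold x, y; ring|rewrite HS; ring]. }
    replace (vx r) with (vx S + (x * ux S - y * uy S)) by lra.
    replace (vy r) with (vy S + (x * uy S + y * ux S)) by lra.
    unfold c, s; split; ring. }
  assert (Hmem : forall a b,
    (in_rectangle r (frame_point S a b) <->
       0 <= (a - x) * c + (b - y) * s <= width r /\
       0 <= (b - y) * c - (a - x) * s <= height r) /\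
    (in_interior r (frame_point S a b) <->
       0 < (a - x) * c + (b - y) * s < width r /\
       0 < (b - y) * c - (a - x) * s < height r)).
  { intros a b. destruct (Hcoord a b) as (px & py & -> & E1 & E2).
    rewrite in_rectangle_coords, in_interior_coords, E1, E2. tauto. }
  clearbody c s x y. clear Hcoord.
  assert (finish : forall B, normal_box B ->
    ((len1 B = width r /\ len2 B = height r) \/ (len1 B = height r /\ len2 B = width r)) ->
    (forall a b,
      (in_box B a b <->
       0 <= (a - x) * c + (b - y) * s <= width r /\
       0 <= (b - y) * c - (a - x) * s <= height r) /\
      (in_open_box B a b <->
       0 < (a - x) * c + (b - y) * s < width r /\
       0 < (b - y) * c - (a - x) * s < height r)) -> represents S r B).
  { intros B HB Hsz HM. split; [exact HB|split; [exact Hsz|]]. intros a b.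
    destruct (HM a b) as [-> ->]. apply Hmem. }
  unfold normal_box, in_box, in_open_box, coord1, coord2 in finish.
  (* the quadrant of the direction (c, s); each is half open, since the normal
     form requires c > 0 but only s >= 0 *)
  assert (Q : {0 < c /\ 0 <= s} + {c <= 0 /\ 0 < s} + {c < 0 /\ s <= 0} +
              {0 <= c /\ s < 0}).
  { destruct (Rlt_le_dec 0 c), (Rlt_le_dec 0 s), (Rlt_le_dec c 0),
      (Rlt_le_dec s 0); auto; exfalso; nra. }
  destruct Q as [[[Q|Q]|Q]|Q].
  - exists (Box x y c s (width r) (height r)).
    apply finish; cbn [corner_x corner_y dir_x dir_y len1 len2]; [lra|lra|]. intros a b; lra.
  - exists (Box (x - height r * s) (y + height r * c) s (- c) (height r) (width r)).
    apply finish; cbn [corner_x corner_y dir_x dir_y len1 len2]; [nra|lra|]. intros a b.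
    replace ((a - (x - height r * s)) * s + (b - (y + height r * c)) * - c)
      with (height r * (c ^ 2 + s ^ 2) - ((b - y) * c - (a - x) * s)) by ring.
    replace ((b - (y + height r * c)) * s - (a - (x - height r * s)) * - c)
      with ((a - x) * c + (b - y) * s) by ring.
    rewrite Hcs. lra.
  - exists (Box (x + width r * c - height r * s) (y + width r * s + height r * c)
             (- c) (- s) (width r) (height r)).
    apply finish; cbn [corner_x corner_y dir_x dir_y len1 len2]; [nra|lra|]. intros a b.
    replace ((a - (x + width r * c - height r * s)) * - c +
             (b - (y + width r * s + height r * c)) * - s)
      with (width r * (c ^ 2 + s ^ 2) - ((a - x) * c + (b - y) * s)) by ring.
    replace ((b - (y + width r * s + height r * c)) * - c -
             (a - (x + width r * c - height r * s)) * - s)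
      with (height r * (c ^ 2 + s ^ 2) - ((b - y) * c - (a - x) * s)) by ring.
    rewrite Hcs. lra.
  - exists (Box (x + width r * c) (y + width r * s) (- s) c (height r) (width r)).
    apply finish; cbn [corner_x corner_y dir_x dir_y len1 len2]; [nra|lra|]. intros a b.
    replace ((a - (x + width r * c)) * - s + (b - (y + width r * s)) * c)
      with ((b - y) * c - (a - x) * s) by ring.
    replace ((b - (y + width r * s)) * - s - (a - (x + width r * c)) * c)
      with (width r * (c ^ 2 + s ^ 2) - ((a - x) * c + (b - y) * s)) by ring.
    rewrite Hcs. lra.
Qed.

(** * Tiles are parallel to the sides of the tiled rectangle *)

(** [Q] holds for all sufficiently small positive numbers. *)
Definition small (Q : R -> Prop) : Prop :=
  exists e, 0 < e /\ forall x, 0 < x < e -> Q x.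

Lemma small_lt e : 0 < e -> small (fun x => x < e).
Proof. intros He. exists e. split; [exact He|]. intros x Hx; lra. Qed.

Lemma small_and P Q : small P -> small Q -> small (fun x => P x /\ Q x).
Proof.
  intros (e1 & He1 & H1) (e2 & He2 & H2). exists (Rmin e1 e2).
  split; [now apply Rmin_glb_lt|]. intros x Hx.
  pose proof (Rmin_l e1 e2). pose proof (Rmin_r e1 e2).
  split; [apply H1|apply H2]; lra.
Qed.

Lemma small_impl P Q : small P -> (forall x, 0 < x -> P x -> Q x) -> small Q.
Proof.
  intros (e & He & H) HPQ. exists e. split; [exact He|]. intros x Hx.
  apply HPQ; [lra|now apply H].
Qed.

Lemma small_forall_lt n (Q : nat -> R -> Prop) :
  (forall k, (k < n)%nat -> small (Q k)) ->
  small (fun x => forall k, (k < n)%nat -> Q k x).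
Proof.
  induction n as [|n IH]; intros H.
  - exists 1. split; [lra|]. intros x _ k Hk; lia.
  - apply small_impl with (fun x => (forall k, (k < n)%nat -> Q k x) /\ Q n x).
    + apply small_and; [apply IH; auto|apply H; lia].
    + intros x _ [H1 H2] k Hk. destruct (Nat.eq_dec k n) as [->|]; [exact H2|].
      apply H1; lia.
Qed.

Lemma small_inhabited Q : small Q -> exists x, 0 < x /\ Q x.
Proof. intros (e & He & H). exists (e / 2). split; [lra|]. apply H; lra. Qed.

(** Six normal boxes tile [0, W] x [0, H], in arbitrary directions. *)
Definition box_tiling (W H : R) (B : nat -> box) : Prop :=
  (forall k, (k < 6)%nat -> normal_box (B k)) /\
  (forall a b, 0 <= a <= W /\ 0 <= b <= H <->
     exists k, (k < 6)%nat /\ in_box (B k) a b) /\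
  (forall i j, (i < 6)%nat -> (j < 6)%nat -> i <> j ->
     forall a b, ~ (in_open_box (B i) a b /\ in_open_box (B j) a b)).

Lemma normal_box_le1 B : normal_box B -> dir_x B <= 1 /\ dir_y B <= 1.
Proof. unfold normal_box. intros H. split; nra. Qed.

(** Points that approach [(x, y)] from the left, with slope tending to 0, are
    eventually outside a tilted box that does not descend below [y]. *)
Lemma probe_leaves_tilted (B : box) x y :
  normal_box B -> 0 < dir_y B -> y <= corner_y B ->
  small (fun e => ~ in_box B (x - e) (y + e ^ 2)).
Proof.
  intros HB Hs Hy. pose proof (normal_box_le1 B HB) as [Hc1 Hs1].
  unfold in_box, coord1, coord2. destruct HB as (Hc & _ & Hcs & Hw & Hh).
  destruct (Rle_lt_dec x (corner_x B)) as [Hx|Hx].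
  - apply small_impl with (1 := small_lt (dir_x B) Hc).
    intros e He Hec [[H _] _]. nra.
  - assert (Hd : 0 < (x - corner_x B) * dir_y B / 2) by nra.
    apply small_impl with (1 := small_and _ _ (small_lt 1 Rlt_0_1) (small_lt _ Hd)).
    intros e He [He1 Hed] [_ [H _]].
    assert (e ^ 2 <= e) by nra.
    assert ((y + e ^ 2 - corner_y B) * dir_x B <= e) by nra.
    nra.
Qed.

(** A straight box containing such points would overlap the tilted box [B] whose
    lowest vertex they approach. *)
Lemma probe_leaves_straight (B C : box) :
  normal_box B -> 0 < dir_y B -> normal_box C -> dir_y C = 0 ->
  (forall a b, ~ (in_open_box B a b /\ in_open_box C a b)) ->
  small (fun e => ~ in_box C (corner_x B - e) (corner_y B + e ^ 2)).
Proof.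
  intros HB Hs HC HsC Hdis. pose proof (normal_box_le1 B HB) as [Hc1 Hs1].
  destruct HB as (Hc & _ & Hcs & Hw & Hh).
  destruct HC as (HcC & _ & HcsC & HwC & HhC).
  assert (dir_x C = 1) by nra.
  assert (E1 : forall a b, coord1 C a b = a - corner_x C).
  { intros a b. unfold coord1. rewrite HsC, H. ring. }
  assert (E2 : forall a b, coord2 C a b = b - corner_y C).
  { intros a b. unfold coord2. rewrite HsC, H. ring. }
  unfold in_box.
  destruct (Rle_lt_dec (corner_x B) (corner_x C)) as [H1|H1].
  { apply small_impl with (1 := small_lt 1 Rlt_0_1).
    intros e He _ Hin. rewrite E1 in Hin. lra. }
  destruct (Rlt_le_dec (corner_x C + len1 C) (corner_x B)) as [H2|H2].
  { assert (Hd : 0 < corner_x B - corner_x C - len1 C) by lra.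
    apply small_impl with (1 := small_lt _ Hd).
    intros e He Hed Hin. rewrite E1 in Hin. lra. }
  destruct (Rlt_le_dec (corner_y B) (corner_y C)) as [H3|H3].
  { assert (Hd : 0 < corner_y C - corner_y B) by lra.
    apply small_impl with (1 := small_and _ _ (small_lt 1 Rlt_0_1) (small_lt _ Hd)).
    intros e He [He1 Hed] Hin. rewrite E2 in Hin. nra. }
  destruct (Rle_lt_dec (corner_y C + len2 C) (corner_y B)) as [H4|H4].
  { apply small_impl with (1 := small_lt 1 Rlt_0_1).
    intros e He _ Hin. rewrite E2 in Hin. nra. }
  exfalso.
  destruct (small_inhabited (fun e => (e < len1 B /\ e < len2 B / 2) /\
     (e < corner_x B - corner_x C /\ e < (corner_y C + len2 C - corner_y B) / 2)))
    as (e & He & (Ha & Hb) & Hd & Hf).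
  { repeat apply small_and; apply small_lt; lra. }
  (* a point of the interior of B up and to the left of its lowest vertex *)
  apply (Hdis (corner_x B - e * dir_y B * dir_x B)
    (corner_y B + e * (dir_y B ^ 2 + 2 * dir_x B ^ 2))).
  unfold in_open_box. rewrite E1, E2. unfold coord1, coord2.
  replace ((corner_x B - e * dir_y B * dir_x B - corner_x B) * dir_x B +
    (corner_y B + e * (dir_y B ^ 2 + 2 * dir_x B ^ 2) - corner_y B) * dir_y B)
    with (e * dir_y B * (dir_x B ^ 2 + dir_y B ^ 2)) by ring.
  replace ((corner_y B + e * (dir_y B ^ 2 + 2 * dir_x B ^ 2) - corner_y B) * dir_x B -
    (corner_x B - e * dir_y B * dir_x B - corner_x B) * dir_y B)
    with (2 * e * dir_x B * (dir_x B ^ 2 + dir_y B ^ 2)) by ring.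
  rewrite Hcs.
  assert (0 < e * dir_y B) by nra. assert (0 < e * dir_x B) by nra.
  assert (e * dir_y B <= e) by nra. assert (e * dir_x B <= e) by nra.
  assert (0 < e * dir_y B * dir_x B) by nra. assert (e * dir_y B * dir_x B <= e) by nra.
  assert (0 < dir_y B ^ 2 + 2 * dir_x B ^ 2 <= 2) by nra.
  assert (0 < e * (dir_y B ^ 2 + 2 * dir_x B ^ 2) <= 2 * e) by nra.
  lra.
Qed.

Lemma none_or_minimal n (Q : nat -> Prop) (f : nat -> R) :
  (forall k, {Q k} + {~ Q k}) ->
  (forall k, (k < n)%nat -> ~ Q k) \/
  exists k, (k < n)%nat /\ Q k /\ forall j, (j < n)%nat -> Q j -> f k <= f j.
Proof.
  intros Hdec. induction n as [|n [IH|(k & Hk & HQ & Hmin)]].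
  - left; intros k Hk; lia.
  - destruct (Hdec n) as [Hn|Hn].
    + right. exists n. split; [lia|split; [exact Hn|]]. intros j Hj HQ.
      destruct (Nat.eq_dec j n) as [->|]; [lra|]. exfalso. apply (IH j); [lia|exact HQ].
    + left. intros k Hk. destruct (Nat.eq_dec k n) as [->|]; [exact Hn|]. apply IH; lia.
  - right. destruct (Hdec n) as [Hn|Hn]; [destruct (Rle_lt_dec (f k) (f n)) as [Hf|Hf]|].
    + exists k. split; [lia|split; [exact HQ|]]. intros j Hj Hq.
      destruct (Nat.eq_dec j n) as [->|]; [exact Hf|]. apply Hmin; [lia|exact Hq].
    + exists n. split; [lia|split; [exact Hn|]]. intros j Hj Hq.
      destruct (Nat.eq_dec j n) as [->|]; [lra|].
      apply Rle_trans with (f k); [lra|]. apply Hmin; [lia|exact Hq].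
    + exists k. split; [lia|split; [exact HQ|]]. intros j Hj Hq.
      destruct (Nat.eq_dec j n) as [->|]; [contradiction|]. apply Hmin; [lia|exact Hq].
Qed.

Lemma tilted_vertex_inside W H (B : box) :
  normal_box B -> 0 < dir_y B ->
  (forall a b, in_box B a b -> 0 <= a <= W /\ 0 <= b <= H) ->
  0 < corner_x B <= W /\ 0 <= corner_y B < H.
Proof.
  intros (Hc & _ & Hcs & Hw & Hh) Hs Hsub.
  destruct (Hsub (corner_x B) (corner_y B)) as [Hx Hy].
  { unfold in_box, coord1, coord2. nra. }
  destruct (Hsub (corner_x B - len2 B * dir_y B) (corner_y B + len2 B * dir_x B)) as [Hx' Hy'].
  { unfold in_box, coord1, coord2.
    replace ((corner_x B - len2 B * dir_y B - corner_x B) * dir_x B +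
      (corner_y B + len2 B * dir_x B - corner_y B) * dir_y B) with 0 by ring.
    replace ((corner_y B + len2 B * dir_x B - corner_y B) * dir_x B -
      (corner_x B - len2 B * dir_y B - corner_x B) * dir_y B)
      with (len2 B * (dir_x B ^ 2 + dir_y B ^ 2)) by ring.
    rewrite Hcs. lra. }
  assert (0 < len2 B * dir_y B) by nra. assert (0 < len2 B * dir_x B) by nra. lra.
Qed.

Lemma box_tiling_straight W H B :
  box_tiling W H B -> forall k, (k < 6)%nat -> dir_y (B k) = 0.
Proof.
  intros (HB & Hcov & Hdis).
  destruct (none_or_minimal 6 (fun k => 0 < dir_y (B k)) (fun k => corner_y (B k)))
    as [Hn|(i & Hi & Hs & Hmin)]; [intros k; apply Rlt_dec| |].
  { intros k Hk. specialize (Hn k Hk). destruct (HB k Hk) as (_ & H0 & _). lra. }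
  exfalso.
  set (x := corner_x (B i)). set (y := corner_y (B i)) in *.
  assert (Hv : 0 < x <= W /\ 0 <= y < H).
  { apply tilted_vertex_inside; auto. intros a b Hab. apply Hcov. eauto. }
  assert (Hd : 0 < H - y) by lra.
  assert (Hout : small (fun e => forall k, (k < 6)%nat ->
                          ~ in_box (B k) (x - e) (y + e ^ 2))).
  { apply small_forall_lt. intros k Hk.
    destruct (Rlt_le_dec 0 (dir_y (B k))) as [Hk0|Hk0].
    - apply probe_leaves_tilted; auto.
    - assert (Hk1 : dir_y (B k) = 0) by (destruct (HB k Hk) as (_ & H0 & _); lra).
      apply probe_leaves_straight; auto. apply Hdis; auto.
      intros ->. lra. }
  destruct (small_inhabited _ (small_and _ _ Hout (small_and _ _
    (small_lt 1 Rlt_0_1) (small_and _ _ (small_lt x (proj1 (proj1 Hv)))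
      (small_lt _ Hd))))) as (e & He & Hno & He1 & Hex & Hey).
  assert (e ^ 2 <= e) by nra. assert (0 <= e ^ 2) by nra.
  destruct (proj1 (Hcov (x - e) (y + e ^ 2))) as [k [Hk Hin]]; [lra|].
  exact (Hno k Hk Hin).
Qed.

Lemma in_straight_box B a b :
  normal_box B -> dir_y B = 0 ->
  (in_box B a b <->
     corner_x B <= a <= corner_x B + len1 B /\
     corner_y B <= b <= corner_y B + len2 B) /\
  (in_open_box B a b <->
     corner_x B < a < corner_x B + len1 B /\
     corner_y B < b < corner_y B + len2 B).
Proof.
  intros (Hc & _ & Hcs & _) Hs. assert (Hc1 : dir_x B = 1) by nra.
  unfold in_box, in_open_box, coord1, coord2. rewrite Hs, Hc1. lra.
Qed.

(** If the half-open rectangle misses [(x, y)], then the closed one misses the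
    points just above and to the right of [(x, y)]. *)
Lemma corner_leaves l r b t x y :
  ~ (l <= x < r /\ b <= y < t) ->
  small (fun e => ~ (l <= x + e <= r /\ b <= y + e <= t)).
Proof.
  intros Hn.
  destruct (Rlt_le_dec x l) as [H|H].
  { apply small_impl with (1 := small_lt (l - x) ltac:(lra)). intros; lra. }
  destruct (Rle_lt_dec r x) as [H'|H'].
  { apply small_impl with (1 := small_lt 1 Rlt_0_1). intros; lra. }
  destruct (Rlt_le_dec y b) as [K|K].
  { apply small_impl with (1 := small_lt (b - y) ltac:(lra)). intros; lra. }
  destruct (Rle_lt_dec t y) as [K'|K'].
  { apply small_impl with (1 := small_lt 1 Rlt_0_1). intros; lra. }
  exfalso; apply Hn; lra.
Qed.

Lemma box_tiling_axis W H B :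
  box_tiling W H B ->
  axis_tiling W H (fun k => corner_x (B k)) (fun k => corner_x (B k) + len1 (B k))
    (fun k => corner_y (B k)) (fun k => corner_y (B k) + len2 (B k)).
Proof.
  intros HT. pose proof (box_tiling_straight W H B HT) as Hs.
  destruct HT as (HB & Hcov & Hdis).
  assert (Hcl : forall k a b, (k < 6)%nat -> in_box (B k) a b <->
    corner_x (B k) <= a <= corner_x (B k) + len1 (B k) /\
    corner_y (B k) <= b <= corner_y (B k) + len2 (B k)).
  { intros k a b Hk. apply in_straight_box; auto. }
  assert (Hop : forall k a b, (k < 6)%nat -> in_open_box (B k) a b <->
    corner_x (B k) < a < corner_x (B k) + len1 (B k) /\
    corner_y (B k) < b < corner_y (B k) + len2 (B k)).
  { intros k a b Hk. apply in_straight_box; auto. }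
  assert (Hpos : forall k, (k < 6)%nat -> 0 < len1 (B k) /\ 0 < len2 (B k)).
  { intros k Hk. destruct (HB k Hk) as (_ & _ & _ & Hw & Hh). auto. }
  split; [|split].
  - intros i Hi. destruct (Hpos i Hi) as [Hw Hh].
    destruct (proj2 (Hcov (corner_x (B i)) (corner_y (B i)))) as [Hx Hy].
    { exists i. split; [exact Hi|]. apply Hcl; lra || auto. }
    destruct (proj2 (Hcov (corner_x (B i) + len1 (B i)) (corner_y (B i) + len2 (B i)))) as [Hx' Hy'].
    { exists i. split; [exact Hi|]. apply Hcl; lra || auto. }
    lra.
  - intros i j Hi Hj Hij. destruct (Hpos i Hi), (Hpos j Hj).
    destruct (Rle_lt_dec (corner_x (B i) + len1 (B i)) (corner_x (B j))); [now left|].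
    destruct (Rle_lt_dec (corner_x (B j) + len1 (B j)) (corner_x (B i))); [now right; left|].
    destruct (Rle_lt_dec (corner_y (B i) + len2 (B i)) (corner_y (B j))); [now right; right; left|].
    destruct (Rle_lt_dec (corner_y (B j) + len2 (B j)) (corner_y (B i))); [now right; right; right|].
    exfalso.
    (* the centre of the common part lies in both interiors *)
    apply (Hdis i j Hi Hj Hij
      ((Rmax (corner_x (B i)) (corner_x (B j)) +
        Rmin (corner_x (B i) + len1 (B i))
             (corner_x (B j) + len1 (B j))) / 2)
      ((Rmax (corner_y (B i)) (corner_y (B j)) +
        Rmin (corner_y (B i) + len2 (B i))
             (corner_y (B j) + len2 (B j))) / 2)).
    rewrite !Hop by assumption. unfold Rmax, Rmin.
    destruct (Rle_dec (corner_x (B i)) (corner_x (B j))), (Rle_dec (corner_y (B i)) (corner_y (B j))),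
      (Rle_dec (corner_x (B i) + len1 (B i)) (corner_x (B j) + len1 (B j))),
      (Rle_dec (corner_y (B i) + len2 (B i)) (corner_y (B j) + len2 (B j))); lra.
  - intros x y Hx Hy.
    (* only the existence of an owner matters here, hence the constant 0 *)
    destruct (none_or_minimal 6 (fun k => corner_x (B k) <= x < corner_x (B k) + len1 (B k) /\
       corner_y (B k) <= y < corner_y (B k) + len2 (B k)) (fun _ => 0))
      as [Hn|(k & Hk & HQ & _)].
    + intros k.
      destruct (Rle_dec (corner_x (B k)) x), (Rlt_dec x (corner_x (B k) + len1 (B k))),
        (Rle_dec (corner_y (B k)) y), (Rlt_dec y (corner_y (B k) + len2 (B k))); tauto.
    + exfalso.
      destruct (small_inhabited (fun e => (forall k, (k < 6)%nat ->
         ~ (corner_x (B k) <= x + e <= corner_x (B k) + len1 (B k) /\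
            corner_y (B k) <= y + e <= corner_y (B k) + len2 (B k))) /\
         e < W - x /\ e < H - y)) as (e & He & Hno & Hex & Hey).
      { apply small_and; [|apply small_and; apply small_lt; lra].
        apply small_forall_lt. intros k Hk. apply corner_leaves, Hn, Hk. }
      destruct (proj1 (Hcov (x + e) (y + e))) as [k [Hk Hin]]; [lra|].
      apply (Hno k Hk), Hcl; assumption.
    + exists k. auto.
Qed.

(** * The square *)

Lemma equal_area_congruent r1 r2 B1 B2 S :
  represents S r1 B1 -> represents S r2 B2 -> area r1 = area r2 ->
  len1 B1 = len1 B2 \/ len2 B1 = len2 B2 -> congruent r1 r2.
Proof.
  intros (_ & H1 & _) (_ & H2 & _). unfold area, congruent. intros HA HE.
  pose proof (width_pos r1). pose proof (height_pos r1).
  pose proof (width_pos r2). pose proof (height_pos r2).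
  assert (K : forall a b c d, 0 < a -> a * b = c * d -> a = c -> b = d).
  { intros a b c d Ha E <-. now apply Rmult_eq_reg_l with a; [|lra]. }
  assert (EA : len1 B1 * len2 B1 = len1 B2 * len2 B2).
  { destruct H1 as [[-> ->]|[-> ->]], H2 as [[-> ->]|[-> ->]]; lra. }
  assert (E : len1 B1 = len1 B2 /\ len2 B1 = len2 B2).
  { destruct HE as [HE|HE]; split; auto.
    - apply (K (len1 B1) (len2 B1) (len1 B2) (len2 B2)); auto.
      destruct H1 as [[-> _]|[-> _]]; assumption.
    - apply (K (len2 B1) (len1 B1) (len2 B2) (len1 B2)); auto.
      + destruct H1 as [[_ ->]|[_ ->]]; assumption.
      + lra. }
  destruct E as [E1 E2].
  destruct H1 as [[F1 F2]|[F1 F2]], H2 as [[G1 G2]|[G1 G2]]; [left|right|right|left];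
    split; lra.
Qed.

Theorem proposition2p2 (S : rectangle) (hS : is_square S) :
  ~ exists P : nat -> rectangle, perfect_mondrian_partition 6 S P.
Proof.
  intros [P [[(_ & Hcov & Hdis) Hncong] Harea]].
  set (B := fun k => proj1_sig (represented S (P k))).
  assert (HB : forall k, represents S (P k) (B k)).
  { intros k. exact (proj2_sig (represented S (P k))). }
  assert (HS : forall a b, in_rectangle S (frame_point S a b) <->
                 0 <= a <= width S /\ 0 <= b <= height S).
  { intros a b. destruct (frame_point S a b) as [px py] eqn:E.
    rewrite in_rectangle_coords.
    symmetry in E. apply frame_point_coords in E as [<- <-]. reflexivity. }
  assert (HT : box_tiling (width S) (height S) B).
  { split; [|split].
    - intros k _. apply (HB k).
    - intros a b. rewrite <- HS, Hcov.
      split; intros [k [Hk Hin]]; exists k; (split; [exact Hk|]);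
        now apply (HB k).
    - intros i j Hi Hj Hij a b [H1 H2].
      apply (Hdis i j Hi Hj Hij (frame_point S a b)).
      split; [now apply (HB i)|now apply (HB j)]. }
  assert (Hcong : forall i j, (i < 6)%nat -> (j < 6)%nat -> i <> j ->
    len1 (B i) = len1 (B j) \/ len2 (B i) = len2 (B j) -> False).
  { intros i j Hi Hj Hij HE. apply (Hncong i j Hi Hj Hij).
    apply (equal_area_congruent _ _ (B i) (B j) S); auto.
    now rewrite !Harea. }
  assert (Hbox : forall k, (k < 6)%nat -> 0 < len1 (B k) /\ 0 < len2 (B k) /\
    len1 (B k) * len2 (B k) = 1 / INR 6 * area S).
  { intros k Hk. rewrite <- (Harea k Hk). unfold area.
    destruct (HB k) as ((_ & _ & _ & Hw & Hh) & Hsz & _).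
    split; [exact Hw|split; [exact Hh|]].
    destruct Hsz as [[-> ->]|[-> ->]]; ring. }
  apply box_tiling_axis, axis_tiling_obstruction in HT as
    [(i & j & Hi & Hj & Hij & HE)|
     (i & j & k & m & (Hi & Hj & Hk & Hm) & Hx & Hy)]; cbn beta in *.
  - apply (Hcong i j Hi Hj Hij). lra.
  - destruct (Hbox i Hi) as (Wi & Hhi & Ai), (Hbox j Hj) as (Wj & Hhj & Aj),
      (Hbox k Hk) as (Wk & Hhk & Ak), (Hbox m Hm) as (Wm & Hhm & Am).
    apply (Hcong i k Hi Hk).
    + intros ->. lra.
    + left.
      apply (frame_opposite_widths (len1 (B i) + len1 (B j)) (len2 (B i) + len2 (B m))
        (1 / INR 6 * area S) _ (len2 (B i)) (len1 (B j)) (len2 (B j)) _ (len2 (B k))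
        (len1 (B m)) (len2 (B m))); lra.
Qed.
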